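(* Let $N\ge 1$ be an integer, $\beta>0$, and let $\varepsilon_1\le\varepsilon_2\le\cdots$ be the (infinite) sequence of single-particle energy eigenvalues, listed with multiplicity, with $\sum_{i}e^{-\beta\varepsilon_i}<\infty$. Let $Z_{BE}(\beta,N)$ be the canonical partition function of the ideal Bose gas of $N$ particles with this single-particle spectrum. Then $$Z_{BE}(\beta,N)=(N)\left(e^{-\beta\varepsilon_1},e^{-\beta\varepsilon_2},\dots\right),$$ where $(N)(x_1,x_2,\dots)$ denotes the $S$-function corresponding to the integer partition $(N)$ of $N$.
   Context: Canonical partition function: for an $N$-particle system, $Z(\beta,N)=\sum_s e^{-\beta E_s}$, summed over all states $s$ of the system with energies $E_s$. For an ideal Bose gas of $N$ particles, a state is a sequence of occupation numbers $(n_i)_{i\ge1}$ of nonnegative integers (no upper bound on each $n_i$) with $\sum_i n_i=N$, and its energy is $\sum_i n_i\varepsilon_i$. Integer partitions: list all $P(N)$ integer partitions of $N$ as $(\lambda)_1,\dots,(\lambda)_{P(N)}$ in decreasing lexicographic order, parts in descending order, so $(\lambda)_1=(N)$ and $(\lambda)_{P(N)}=(1^N)$. Let $a_{J,m}$ be the number of times $m$ occurs as a part of $(\lambda)_J$, and $g_J=N!\left(\prod_{j=1}^N j^{a_{J,j}}a_{J,j}!\right)^{-1}$. $S$-function (Schur function) of infinitely many variables corresponding to $(\lambda)_I$: $$(\lambda)_I(x_1,x_2,\dots)=\sum_{J=1}^{P(N)}\frac{g_J}{N!}\,\chi_J^I\prod_{m=1}^{N}\Big(\sum_i x_i^m\Big)^{a_{J,m}},$$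 where $\chi^I_J$ is the value of the irreducible character of the symmetric group $S_N$ indexed by the partition $(\lambda)_I$ on the conjugacy class of cycle type $(\lambda)_J$ (with the convention that $(N)$ indexes the trivial character and $(1^N)$ the sign character). In particular, $(N)(x_1,x_2,\dots)$ is the case $I=1$. *)

(* Defs.v *)
From HB Require Import structures.
From mathcomp Require Import all_boot all_order all_fingroup all_algebra.
From mathcomp Require Import all_field all_character.
From mathcomp Require Import all_classical all_reals all_analysis.

Set Implicit Arguments.
Unset Strict Implicit.
Unset Printing Implicit Defensive.

Import Order.TTheory GRing.Theory Num.Theory.
Import numFieldNormedType.Exports.

(* Integer partitions are lists of positive parts in descending order;
   [intparts_rec f k n] lists those of n with all parts at most k, provided
   that the recursion bound f is at least n. *)
Fixpoint intparts_rec (f k n : nat) : seq (seq nat) :=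
  match n, f with
  | 0, _ => [:: [::]]
  | _, 0 => [::]
  | _, f'.+1 =>
      flatten [seq [seq j :: mu | mu <- intparts_rec f' j (n - j)]
              | j <- rev (iota 1 (minn k n))]
  end.

Definition intparts (N : nat) : seq (seq nat) := intparts_rec N N N.

Definition is_intpart (N : nat) (mu : seq nat) : bool :=
  [&& sorted geq mu, 0%N \notin mu & sumn mu == N].

Lemma mem_intparts_rec f k n mu : (n <= f)%N ->
  (mu \in intparts_rec f k n) = is_intpart n mu && all (geq k) mu.
Proof.
elim: f k n mu => [|f IH] k [|n] mu //=.
1,2: by move=> _; case: mu => [|[|a] mu] //;
     rewrite /is_intpart /= !inE ?orTb ?andbF //= addSn andbF.
rewrite ltnS => lenf; apply/flatten_mapP/idP.
  case=> j; rewrite mem_rev mem_iota add1n ltnS leq_min => /and3P[j0 jk jn].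
  case/mapP=> nu; rewrite IH; last first.
    by case: j j0 {jk jn} => // j _; rewrite subSS (leq_trans (leq_subr _ _)).
  case/andP=> /and3P[snu nu0 /eqP sum_nu] alln ->.
  rewrite /is_intpart /= inE negb_or neq_ltn j0 nu0 sum_nu subnKC // eqxx jk /=.
  rewrite path_sortedE; last by move=> a b c /= ? /leq_trans; apply.
  rewrite snu andbT alln /=; apply/allP => i /(allP alln) /= ij.
  exact: leq_trans ij jk.
case: mu => [|j mu]; rewrite /is_intpart //= inE.
rewrite path_sortedE; last by move=> a b c /= ? /leq_trans; apply.
rewrite negb_or [0 == _]eq_sym -lt0n.
case/andP=> /and3P[/andP[allj smu] /andP[j0 mu0] /eqP sumj] /andP[jk _].
have jn : (j <= n.+1)%N by rewrite -sumj leq_addr.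
exists j; first by rewrite mem_rev mem_iota add1n ltnS leq_min j0 jk jn.
apply/mapP; exists mu => //; rewrite IH.
  by rewrite /is_intpart smu mu0 allj andbT -sumj addKn eqxx.
by case: j j0 {allj sumj jk jn} => // j _; rewrite subSS (leq_trans (leq_subr _ _)).
Qed.

Lemma mem_intparts N mu : (mu \in intparts N) = is_intpart N mu.
Proof.
rewrite mem_intparts_rec // andb_idr // => /and3P[_ _ /eqP <-].
apply/allP => i; elim: mu => //= a mu IH; rewrite inE => /orP[/eqP->|/IH].
  exact: leq_addr.
by move=> /leq_trans; apply; exact: leq_addl.
Qed.

Lemma intparts_rec_decreasing f k n : pairwise >%O (intparts_rec f k n : seq (seqlexi nat)).
Proof.
elim: f k n => [|f IH] k [|n] //=.
elim: (minn k n.+1) => // m IHm.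
rewrite -[m.+1]addn1 iotaD rev_cat /= add1n pairwise_cat IHm.
rewrite andbT; apply/andP; split.
  apply/allrelP => x y /mapP[mu _ ->] /flatten_mapP[j].
  rewrite mem_rev mem_iota add1n ltnS => /andP[_ jm] /mapP[nu _ ->].
  suff: (j <= m.+1)%O && ((m.+1 <= j)%O ==> ((nu : seqlexi nat) < mu)%O) by [].
  by rewrite !leEnat (leq_trans jm) //= leqNgt ltnS jm.
rewrite pairwise_map; apply: sub_pairwise (IH m.+1 (n - m)) => mu nu /= mu_nu.
suff: (m.+1 <= m.+1)%O && ((m.+1 <= m.+1)%O ==> ((nu : seqlexi nat) < mu)%O) by [].
by rewrite lexx.
Qed.

Lemma intparts_decreasing N :
  sorted >%O (intparts N : seq (seqlexi nat)).
Proof.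
rewrite sorted_pairwise; first exact: intparts_rec_decreasing.
by move=> a b c ab bc; apply: lt_trans bc ab.
Qed.

Local Open Scope classical_set_scope.
Local Open Scope ring_scope.

Section SymmetricGroupCharacters.
Variable N : nat.

Definition cycle_type (s : 'S_N) : seq nat :=
  sort geq [seq #|c| | c : {set 'I_N} <- enum (porbits s)].

(* The row and column groups of the tableau of shape lam filled with
   0, 1, ..., N-1 row by row, where lam is a partition of N. *)
Definition row_group (lam : seq nat) : {set 'S_N} :=
  [set s : 'S_N | [forall k, reshape_index lam (s k) == reshape_index lam k]]%SET.

Definition column_group (lam : seq nat) : {set 'S_N} :=
  [set s : 'S_N | [forall k, reshape_offset lam (s k) == reshape_offset lam k]]%SET.

(* The group algebra of S_N is the space of row vectors carrying the regular
   representation: s corresponds to the basis vector number gring_index s. *)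
Definition young_symmetrizer (lam : seq nat) : 'rV[algC]_#|[set: 'S_N]%SET| :=
  \sum_(p in row_group lam) \sum_(q in column_group lam)
    (-1) ^+ odd_perm q *: delta_mx 0 (gring_index [set: 'S_N]%G (p * q)%g).

(* The irreducible character indexed by lam, afforded by the ideal that the
   Young symmetrizer generates in the group algebra (Specht module); [:: N]
   gives the trivial character and nseq N 1 the sign character. *)
Definition specht_char (lam : seq nat) : 'CF([set: 'S_N]%G) :=
  cfRepr (submod_repr
    (cyclic_mx_module (regular_repr algC [set: 'S_N]%G) (young_symmetrizer lam))).

(* Characters of S_N are integer valued, so that Num.floor only changes the
   type of the value, from algC to int. *)
Definition char_value (lam mu : seq nat) : int :=
  Num.floor (specht_char lam (repr [set s : 'S_N | cycle_type s == mu]%SET)).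

End SymmetricGroupCharacters.

Section SFunction.
Variables (R : realType) (N : nat).

Definition class_size (mu : seq nat) : R :=
  N`!%:R *
  (\prod_(1 <= j < N.+1) (j ^ count_mem j mu * (count_mem j mu)`!)%N%:R)^-1.

Definition S_function (lam : seq nat) (x : nat -> R) : R :=
  \sum_(mu <- intparts N)
    class_size mu / N`!%:R * (char_value N lam mu)%:~R *
    \prod_(1 <= m < N.+1) (limn (series (fun i => x i ^+ m))) ^+ count_mem m mu.

End SFunction.

Definition canonical_partition_function (R : realType) (S : choiceType)
    (states : set S) (energy : S -> R) (beta : R) : \bar R :=
  \esum_(s in states) (expR (- beta * energy s))%:E.

(* Levels are numbered from 0. The sums over all levels i are finite-support sums (set to 0 on functions
   of infinite support), hence the first condition. *)
Definition bose_states (N : nat) : set (nat -> nat) :=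
  [set n | finite_set [set i | n i != 0%N] /\
           (\big[addn/0%N]_(i \in [set: nat]) n i = N)].

Definition occupation_energy (R : realType) (eps : nat -> R) (n : nat -> nat) : R :=
  \sum_(i \in [set: nat]) (n i)%:R * eps i.

Definition Z_BE (R : realType) (eps : nat -> R) (beta : R) (N : nat) : \bar R :=
  canonical_partition_function (bose_states N) (occupation_energy eps) beta.

(* Main.v *)
(** For the one-row partition [(N)] the Young symmetrizer is the sum of all
    permutations; it spans a fixed line of the group algebra, so every character
    value is [1] and the S-function is the cycle index
    [sum_mu prod_j p_j ^ a_j / (j ^ a_j a_j!)] in the power sums [p_j].  Both the
    cycle index and the partition function satisfy Newton's recurrence
    [N F_N = sum_(1 <= k <= N) p_k F_(N-k)] with [F_0 = 1]: on the first side one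
    removes a part [k] from [mu] (as [N = sum_k k a_k]), on the second one removes
    [k] bosons from level [i] (as [N] is the number of pairs [(i, k)] with
    [1 <= k <= n_i]). *)

Require Import Defs.
From mathcomp Require Import all_boot all_order all_fingroup all_algebra.
From mathcomp Require Import all_field all_character finmap ring.
From mathcomp Require Import all_classical all_reals all_analysis.

Set Implicit Arguments.
Unset Strict Implicit.
Unset Printing Implicit Defensive.

Import Order.TTheory GRing.Theory Num.Theory.
Import numFieldNormedType.Exports.

Local Open Scope classical_set_scope.
Local Open Scope ring_scope.

(** * The one-row Specht module and its trivial character *)

Lemma row_group1 (N : nat) : row_group N [:: N] = [set: 'S_N]%SET.
Proof.
apply/setP => s; rewrite !inE; apply/forallP => k.
by rewrite /reshape_index /= !subn_eq0 !ltn_ord.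
Qed.

Lemma column_group1 (N : nat) : column_group N [:: N] = [set 1%g]%SET.
Proof.
apply/setP => s; rewrite !inE; apply/forallP/eqP => [off_s|-> k]; last by rewrite perm1.
apply/permP => k; apply/val_inj; rewrite perm1; have /eqP := off_s k.
by rewrite /reshape_offset /reshape_index /= !subn_eq0 !ltn_ord /= !subn0.
Qed.

Lemma young_symmetrizer1 (N : nat) :
  young_symmetrizer N [:: N] =
  \sum_(s : 'S_N) delta_mx 0 (gring_index [set: 'S_N]%G s).
Proof.
rewrite /young_symmetrizer row_group1 column_group1.
by apply: eq_big => [s|s _]; rewrite ?inE // big_set1 odd_perm1 expr0 scale1r mulg1.
Qed.

(** Right translation by [s] only permutes the terms of the sum over all of ['S_N]. *)
Lemma young_symmetrizer1_fixed (N : nat) (s : 'S_N) :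
  young_symmetrizer N [:: N] *m regular_repr algC [set: 'S_N]%G s =
  young_symmetrizer N [:: N].
Proof.
rewrite young_symmetrizer1 mulmx_suml [RHS](reindex_inj (mulIg s)) /=.
by apply: eq_bigr => t _; rewrite -rowE rowK gring_indexK ?inE.
Qed.

Lemma young_symmetrizer1_neq0 (N : nat) : young_symmetrizer N [:: N] != 0.
Proof.
(* The coordinate at the identity is a sum of nonnegative terms, one of which is 1. *)
apply/eqP => /rowP/(_ (gring_index [set: 'S_N]%G 1%g))/eqP.
rewrite young_symmetrizer1 summxE mxE psumr_eq0 => [/allP/(_ 1%g)|s _].
  by rewrite mem_index_enum mxE !eqxx oner_eq0 => /(_ isT).
by rewrite mxE; apply: ler0n.
Qed.

(** The line through a fixed vector is already stable, so it contains the smallest submodule through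
    [v]. *)
Lemma cyclic_mx_fixed (gT : finGroupType) (G : {group gT}) (F : fieldType) (n : nat)
    (rG : mx_representation F G n) (v : 'rV[F]_n) :
  {in G, forall x, v *m rG x = v} -> (cyclic_mx rG v :=: v)%MS.
Proof.
move=> fix_v; apply/eqmxP; rewrite cyclic_mx_id andbT.
by apply: cyclic_mx_sub => //; apply/mxmoduleP => x Gx; rewrite fix_v.
Qed.

Lemma specht_char1 (N : nat) (s : 'S_N) : specht_char N [:: N] s = 1.
Proof.
rewrite /specht_char cfunE.
rewrite inE mulr1n /=.
set rG := regular_repr _ _; set v := young_symmetrizer _ _.
have eqv : (cyclic_mx rG v :=: v)%MS.
  by apply: cyclic_mx_fixed => x _; apply: young_symmetrizer1_fixed.
rewrite /submod_mx.
(* The basis vectors of the ideal are multiples of [v], hence fixed by [s]; the trace is then that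
   of an identity matrix whose size is the rank 1 of the line. *)
have -> : val_submod 1%:M *m rG s = val_submod (1%:M : 'M[algC]_(\rank (cyclic_mx rG v))).
  have /submxP[D ->] : (val_submod (1%:M : 'M[algC]_(\rank (cyclic_mx rG v))) <= v)%MS.
    by rewrite -eqv val_submodP.
  by rewrite -mulmxA young_symmetrizer1_fixed.
by rewrite val_submodK mxtrace1 eqv rank_rV young_symmetrizer1_neq0.
Qed.

(** As [specht_char1] covers every permutation, the representative picked by [repr] does not affect
    the value. *)
Lemma char_value1 (N : nat) (mu : seq nat) : char_value N [:: N] mu = 1.
Proof. by rewrite /char_value specht_char1 floor1. Qed.

(** * The cycle index and its Newton recurrence *)

Section CycleIndex.
Variables (R : realType) (p : nat -> R).

Definition part_weight (mu : seq nat) (j : nat) : R :=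
  p j ^+ count_mem j mu / (j ^ count_mem j mu * (count_mem j mu)`!)%N%:R.

(** The bound [M] is kept apart from the size of [mu], so that a partition and what is left after
    removing a part can be compared over the same range. *)
Definition cycle_weight (M : nat) (mu : seq nat) : R :=
  \prod_(1 <= j < M.+1) part_weight mu j.

Definition cycle_index (N : nat) : R := \sum_(mu <- intparts N) cycle_weight N mu.

Lemma cycle_index0 : cycle_index 0 = 1.
Proof. by rewrite /cycle_index /cycle_weight big_seq1 big_nil. Qed.

Lemma perm_cycle_weight M mu nu : perm_eq mu nu -> cycle_weight M mu = cycle_weight M nu.
Proof.
move=> /seq.permP eq_count; apply: eq_bigr => j _.
by rewrite /part_weight !eq_count.
Qed.

Lemma leq_part N mu j : is_intpart N mu -> j \in mu -> (1 <= j <= N)%N.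
Proof.
move=> muN jmu; have /and3P[_ mu0 /eqP <-] := muN; apply/andP; split.
  by case: j jmu => // /(negP mu0).
elim: mu jmu {muN mu0} => //= i mu IH; rewrite inE => /predU1P[->|/IH le_j].
  exact: leq_addr.
by rewrite (leq_trans le_j) ?leq_addl.
Qed.

(** No part exceeds [N], so each extra factor has multiplicity 0 and equals 1. *)
Lemma cycle_weight_widen M N mu :
  is_intpart N mu -> (N <= M)%N -> cycle_weight M mu = cycle_weight N mu.
Proof.
move=> muN leNM; rewrite /cycle_weight (@big_cat_nat _ _ _ N.+1) //=.
rewrite [X in _ * X]big_nat_cond [X in _ * X]big1 ?mulr1 // => j.
rewrite andbT => /andP[ltNj _].
have /count_memPn jmu : j \notin mu.
  by apply: contraL ltNj => /(leq_part muN)/andP[_]; rewrite -leqNgt.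
by rewrite /part_weight jmu expr0 mul1r invr1.
Qed.

Lemma sumn_count n mu : all (fun i => 1 <= i < n.+1)%N mu ->
  sumn mu = (\sum_(1 <= k < n.+1) k * count_mem k mu)%N.
Proof.
elim: mu => [_|a mu IH /= /andP[a_le /IH ->]].
  by rewrite big1 // => k _; rewrite muln0.
under [RHS]eq_bigr do rewrite mulnDr.
rewrite big_split /=; congr addn.
rewrite (bigD1_seq a) ?mem_index_iota ?iota_uniq //= eqxx muln1 big1 ?addn0 //.
by move=> k /negPf; rewrite eq_sym => ->; rewrite muln0.
Qed.

(** A further part [k] raises the multiplicity [a] of [k] to [a.+1], which multiplies the weight by
    [p k / (k * a.+1)]; the other factors do not change. *)
Lemma cycle_weight_cons M k mu : (1 <= k <= M)%N ->
  (k * (count_mem k mu).+1)%:R * cycle_weight M (k :: mu) = p k * cycle_weight M mu.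
Proof.
move=> kM; have kiota : k \in index_iota 1 M.+1 by rewrite mem_index_iota ltnS.
rewrite /cycle_weight !(bigD1_seq k kiota) ?iota_uniq //= !mulrA; congr (_ * _); last first.
  by apply: eq_bigr => j /negPf; rewrite /part_weight /= eq_sym => ->.
rewrite /part_weight /= eqxx add1n exprS expnS factS; set a := count_mem k mu.
have k0 : k%:R != 0 :> R by rewrite pnatr_eq0 -lt0n; case/andP: kM.
have a0 : a.+1%:R != 0 :> R by rewrite pnatr_eq0.
have f0 : a`!%:R != 0 :> R by rewrite pnatr_eq0 -lt0n fact_gt0.
rewrite !natrM !natrX; field.
by rewrite f0 k0 nat1r a0 expf_neq0.
Qed.

Lemma intparts_uniq N : uniq (intparts N).
Proof.
apply: (@sorted_uniq _ (fun mu nu : seqlexi nat => nu < mu)%O).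
- by move=> a b c ab bc; apply: lt_trans bc ab.
- by move=> a; rewrite ltxx.
- exact: intparts_decreasing.
Qed.

Lemma geq_total : total geq. Proof. by move=> a b; apply: leq_total. Qed.
Lemma geq_trans : transitive geq. Proof. by move=> a b c ab /leq_trans; apply. Qed.
Lemma geq_anti : antisymmetric geq. Proof. by move=> a b; rewrite andbC; apply: anti_leq. Qed.

(** A nonincreasing list is determined by its multiset of entries. Together with [rem_sort_cons],
    this makes removal and sorted insertion of [k] mutually inverse. *)
Lemma sort_cons_rem N k mu : is_intpart N mu -> k \in mu -> sort geq (k :: rem k mu) = mu.
Proof.
move=> /and3P[s_mu _ _] kmu; apply: (sorted_eq geq_trans geq_anti) => //.
  exact: sort_sorted geq_total _.
by rewrite perm_sort perm_sym perm_to_rem.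
Qed.

Lemma rem_sort_cons N k nu : is_intpart N nu -> rem k (sort geq (k :: nu)) = nu.
Proof.
move=> /and3P[s_nu _ _]; apply: (sorted_eq geq_trans geq_anti) => //.
  by apply: (subseq_sorted geq_trans (rem_subseq _ _)); apply: sort_sorted geq_total _.
have kin : k \in sort geq (k :: nu) by rewrite mem_sort mem_head.
by rewrite -(perm_cons k) -(permPl (perm_to_rem kin)) perm_sort.
Qed.

Lemma is_intpart_rem N k mu : is_intpart N mu -> k \in mu -> is_intpart (N - k) (rem k mu).
Proof.
move=> /and3P[s_mu mu0 /eqP <-] kmu; apply/and3P; split.
- exact: (subseq_sorted geq_trans (rem_subseq _ _)).
- by apply: contra mu0; apply: mem_rem.
- by rewrite (perm_sumn (perm_to_rem kmu)) /= addKn.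
Qed.

Lemma is_intpart_sort_cons N k nu : (1 <= k <= N)%N -> is_intpart (N - k) nu ->
  is_intpart N (sort geq (k :: nu)).
Proof.
move=> /andP[k0 kN] /and3P[_ nu0 /eqP sum_nu]; apply/and3P; split.
- exact: sort_sorted geq_total _.
- by rewrite mem_sort inE negb_or nu0 andbT neq_ltn k0.
- have /permEl/perm_sumn -> := perm_sort geq (k :: nu).
  by rewrite /= sum_nu subnKC.
Qed.

Lemma perm_intparts_rem N k : (1 <= k <= N)%N ->
  perm_eq [seq mu <- intparts N | k \in mu]
          [seq sort geq (k :: nu) | nu <- intparts (N - k)].
Proof.
move=> kN; apply: uniq_perm.
- by rewrite filter_uniq ?intparts_uniq.
- rewrite map_inj_in_uniq ?intparts_uniq // => mu nu.
  rewrite !mem_intparts => mu_part nu_part eq_sort.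
  by rewrite -(rem_sort_cons k mu_part) eq_sort (rem_sort_cons k nu_part).
move=> mu; rewrite mem_filter mem_intparts; apply/andP/mapP.
  move=> [kmu mu_part]; exists (rem k mu); first by rewrite mem_intparts is_intpart_rem.
  by rewrite (sort_cons_rem mu_part).
move=> [nu]; rewrite mem_intparts => nu_part ->.
by rewrite is_intpart_sort_cons // mem_sort mem_head.
Qed.

Lemma cycle_index_rec N :
  N%:R * cycle_index N = \sum_(1 <= k < N.+1) p k * cycle_index (N - k).
Proof.
rewrite /cycle_index mulr_sumr.
(* The factor [N] is written as the sum of [k * count_mem k mu]. *)
transitivity (\sum_(mu <- intparts N) \sum_(1 <= k < N.+1)
    (k * count_mem k mu)%:R * cycle_weight N mu).
  apply: eq_big_seq => mu; rewrite mem_intparts => muN.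
  rewrite -mulr_suml -natr_sum -sumn_count; first by case/and3P: muN => _ _ /eqP ->.
  by apply/allP => i /(leq_part muN).
rewrite exchange_big big_nat [RHS]big_nat; apply: eq_bigr => k; rewrite ltnS => kN /=.
(* Partitions without the part [k] have multiplicity 0 and drop out; the others are reindexed by the
   partition of [N - k] left after removing one [k]. *)
rewrite (bigID (fun mu => k \in mu)) /= [X in _ + X]big1 ?addr0; last first.
  by move=> mu /count_memPn ->; rewrite muln0 mul0r.
rewrite -big_filter (perm_big _ (perm_intparts_rem kN)) big_map mulr_sumr.
apply: eq_big_seq => nu; rewrite mem_intparts => nu_part.
have /permEl eqs := perm_sort geq (k :: nu).
rewrite (perm_cycle_weight _ eqs) (seq.permP eqs) /= eqxx add1n cycle_weight_cons //.
by rewrite (cycle_weight_widen nu_part) ?leq_subr.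
Qed.

End CycleIndex.

(** * Sums with finite support *)

Lemma fsbigT_split (T : choiceType) (V : eqType) (idx : V) (op : Monoid.com_law idx)
    (f g : T -> V) :
  finite_set [set i | f i != idx] -> finite_set [set i | g i != idx] ->
  \big[op/idx]_(i \in [set: T]) op (f i) (g i) =
  op (\big[op/idx]_(i \in [set: T]) f i) (\big[op/idx]_(i \in [set: T]) g i).
Proof.
(* Both supports lie in the finite set [A], over which all three sums become ordinary ones. *)
move=> finf fing; pose A := (fset_set [set i | f i != idx] `|` fset_set [set i | g i != idx])%fset.
have fA i : i \notin A -> f i = idx.
  rewrite in_fsetU negb_or in_fset_set // => /andP[/negP fi _].
  by apply/eqP/negPn/negP => nfi; apply: fi; rewrite inE.
have gA i : i \notin A -> g i = idx.
  rewrite in_fsetU negb_or (in_fset_set fing) => /andP[_ /negP gi].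
  by apply/eqP/negPn/negP => ngi; apply: gi; rewrite inE.
rewrite (fsbigTE _ _ fA) (fsbigTE _ _ gA) -big_split /=.
by apply: fsbigTE => i iA; rewrite fA // gA // Monoid.mul1m.
Qed.

Lemma fsbigT_delta (T : choiceType) (V : eqType) (idx : V) (op : Monoid.com_law idx)
    (i0 : T) (v : V) :
  \big[op/idx]_(i \in [set: T]) (if i == i0 then v else idx) = v.
Proof.
rewrite (@fsbigTE _ _ _ _ [fset i0]%fset) ?big_seq_fset1 ?eqxx // => i.
by rewrite in_fset1 => /negPf ->.
Qed.

Lemma finite_support_delta (T : choiceType) (V : eqType) (idx : V) (i0 : T) (v : V) :
  finite_set [set i | (if i == i0 then v else idx) != idx].
Proof.
apply: (sub_finite_set _ (finite_set1 i0)) => i /=.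
by case: (eqVneq i i0) => // _; rewrite eqxx.
Qed.

(** * Adding bosons to a level and removing them *)

Definition add_bosons (i k : nat) (m : nat -> nat) (j : nat) : nat :=
  (m j + (if j == i then k else 0))%N.

Definition remove_bosons (i k : nat) (n : nat -> nat) (j : nat) : nat :=
  (n j - (if j == i then k else 0))%N.

Lemma remove_bosonsK i k n : (k <= n i)%N -> add_bosons i k (remove_bosons i k n) = n.
Proof.
move=> le_k; apply/funext => j; rewrite /add_bosons /remove_bosons.
by case: eqP => [->|_]; rewrite ?subnK // subn0 addn0.
Qed.

Lemma add_bosonsK i k : cancel (add_bosons i k) (remove_bosons i k).
Proof. by move=> m; apply/funext => j; rewrite /add_bosons /remove_bosons addnK. Qed.

Lemma sum_add_bosons i k m : finite_set [set j | m j != 0%N] ->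
  (\big[addn/0]_(j \in [set: nat]) add_bosons i k m j)%N =
  (\big[addn/0]_(j \in [set: nat]) m j + k)%N.
Proof.
move=> finm; rewrite fsbigT_split //; last exact: finite_support_delta.
by rewrite fsbigT_delta.
Qed.

(** Putting the [k] bosons back shows that [N] is the remaining total plus [k], which yields both
    claims. *)
Lemma bose_states_remove N i k n : bose_states N n -> (k <= n i)%N ->
  (k <= N)%N /\ bose_states (N - k) (remove_bosons i k n).
Proof.
move=> [finn sumn] le_k.
have finr : finite_set [set j | remove_bosons i k n j != 0%N].
  apply: sub_finite_set finn => j /=; rewrite /remove_bosons -!lt0n subn_gt0.
  exact: leq_trans.
have eqN : N = (\big[addn/0]_(j \in [set: nat]) remove_bosons i k n j + k)%N.
  by rewrite -(sum_add_bosons i) // remove_bosonsK.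
by split; [rewrite eqN leq_addl | split => //; rewrite [in RHS]eqN addnK].
Qed.

Lemma bose_states_le N i n : bose_states N n -> (n i <= N)%N.
Proof. by move=> /(@bose_states_remove _ i)/(_ (leqnn _))[]. Qed.

Lemma add_bosons_bij N i k : (k <= N)%N ->
  set_bij (bose_states (N - k)) (bose_states N `&` [set n | (k <= n i)%N])
    (add_bosons i k).
Proof.
move=> kN; split.
- move=> m [finm summ]; split; last by rewrite /= /add_bosons eqxx leq_addl.
  split; last by rewrite sum_add_bosons // summ subnK.
  apply: (sub_finite_set (B := [set j | m j != 0%N] `|` [set i])).
    move=> j /=; rewrite /add_bosons; case: (j =P i) => [->|_]; first by right.
    by rewrite addn0; left.
  by rewrite finite_setU.
- by move=> m m' _ _; apply: (can_inj (@add_bosonsK i k)).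
- move=> n [Nn le_k]; exists (remove_bosons i k n); last exact: remove_bosonsK.
  by have [] := bose_states_remove Nn le_k.
Qed.

(** * Nonnegative sums in the extended reals *)

Lemma esumZl (R : realType) (T : choiceType) (I : set T) (c : R) (a : T -> \bar R) :
  0 <= c -> (forall i, 0 <= a i)%E ->
  (\esum_(i in I) (c%:E * a i) = c%:E * \esum_(i in I) a i)%E.
Proof.
move=> c0 a0; rewrite /esum -ereal_supZl //; last first.
  (* Scaling a supremum asks for a nonempty family; the empty partial sum is a member. *)
  by apply/set0P; exists 0%E; exists set0; rewrite ?fsbig_set0 //; exact: fsets_set0.
congr ereal_sup; apply/seteqP; split => [_ [A IA <-]|_ [_ [A IA <-] <-]].
  by exists (\sum_(i \in A) a i)%E; [exists A | rewrite ge0_mule_fsumr].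
by exists A; rewrite ?ge0_mule_fsumr.
Qed.

Lemma esum_finite_support (R : realType) (T : choiceType) (a : T -> R) :
  finite_set [set i | a i != 0] -> (forall i, 0 <= a i) ->
  (\esum_(i in [set: T]) (a i)%:E = (\sum_(i \in [set: T]) a i)%:E)%E.
Proof.
move=> fina a0; set S := [set i | a i != 0].
transitivity (\esum_(i in S) (a i)%:E)%E.
  rewrite [RHS]esum_mkcond; apply: eq_esum => i _; case: ifPn => // /negP iS.
  by apply/eqP; rewrite eqe; apply/negPn/negP => ai; apply: iS; rewrite inE.
rewrite esum_fset => [||i _]; rewrite ?lee_fin // fsumEFin //; congr EFin.
by apply: fsbig_widen => // i [_ /= /negP/negPn/eqP].
Qed.

(** After exchanging the sums, level [i] is counted once for each [k] from 1 to [n i]. Since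
    [n i <= N], the cut-off at [N] loses nothing. *)
Lemma esum_bosons (R : realType) N n : bose_states N n ->
  (\sum_(1 <= k < N.+1) \esum_(i in [set i | (k <= n i)%N]) (1%:E : \bar R) = N%:R%:E)%E.
Proof.
move=> Nn; have [finn sumn] := Nn.
under eq_bigr do rewrite esum_mkcond.
rewrite -esum_sum => [|i k _ _]; last by case: ifP => _; rewrite lee_fin.
transitivity (\esum_(i in [set: nat]) ((n i)%:R%:E : \bar R))%E.
  apply: eq_esum => i _.
  have le_n := bose_states_le i Nn.
  rewrite (@big_cat_nat _ _ _ (n i).+1) //= [X in (_ + X)%E]big_nat_cond.
  rewrite [X in (_ + X)%E]big1 ?adde0 => [|k]; last first.
    rewrite andbT => /andP[lt_k _]; case: ifPn => //; rewrite inE /= leqNgt.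
    by rewrite lt_k.
  rewrite big_nat (eq_bigr (fun=> 1%E)) => [|k /andP[_ lt_k]]; last first.
    by rewrite ifT // inE /= -ltnS.
  by rewrite -big_nat sumEFin sumr_const_nat subn1.
rewrite esum_finite_support //; last first.
  by apply: sub_finite_set finn => i /=; rewrite pnatr_eq0.
congr EFin; rewrite -sumn.
have nA i : i \notin fset_set [set j | n j != 0%N] -> n i = 0%N.
  rewrite in_fset_set // => /negP ni.
  by apply/eqP/negPn/negP => nni; apply: ni; rewrite inE.
by rewrite (fsbigTE _ _ nA) natr_sum; apply: fsbigTE => i /nA ->.
Qed.

(** * The Newton recurrence for the partition function *)

Section BosePartitionFunction.
Variables (R : realType) (eps : nat -> R) (beta : R).

Local Notation weight n := (expR (- beta * occupation_energy eps n)).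
Local Notation x i := (expR (- beta * eps i)).

Lemma weight_add_bosons i k m : finite_set [set j | m j != 0%N] ->
  weight (add_bosons i k m) = x i ^+ k * weight m.
Proof.
move=> finm; rewrite -expRM_natl -expRD; congr expR.
rewrite /occupation_energy.
under eq_fsbigr do rewrite natrD mulrDl.
rewrite fsbigT_split /=; last 2 first.
- by apply: sub_finite_set finm => j /=; apply: contra => /eqP ->; rewrite mul0r.
- apply: (sub_finite_set _ (finite_set1 i)) => j /=.
  by case: (eqVneq j i) => // _; rewrite mul0r eqxx.
have -> : \sum_(j \in [set: nat]) (if j == i then k else 0%N)%:R * eps j = k%:R * eps i.
  rewrite -[RHS](@fsbigT_delta nat _ 0 +%R i); apply: eq_fsbigr => j _.
  by case: eqVneq => [->|]; rewrite ?mul0r.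
ring.
Qed.

(** Nonnegativity of the terms justifies every exchange of sums in [\bar R], infinite values
    included. *)
Lemma Z_BE_rec N :
  (N%:R%:E * Z_BE eps beta N =
   \sum_(1 <= k < N.+1) \esum_(i in [set: nat]) ((x i ^+ k)%:E * Z_BE eps beta (N - k)))%E.
Proof.
have w0 n : (0 <= (weight n)%:E)%E by rewrite lee_fin expR_ge0.
rewrite -esumZl //.
transitivity (\esum_(n in bose_states N) \sum_(1 <= k < N.+1)
    \esum_(i in [set i | (k <= n i)%N]) (weight n)%:E)%E.
  apply: eq_esum => n Nn; rewrite -(esum_bosons R Nn) muleC ge0_sume_distrr => [|k _].
    apply: eq_bigr => k _; rewrite -esumZl ?expR_ge0 //.
    by apply: eq_esum => i _; rewrite mule1.
  by apply: esum_ge0 => i _; rewrite lee_fin.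
rewrite esum_sum => [|n k _ _]; last exact: esum_ge0.
rewrite big_nat [RHS]big_nat; apply: eq_bigr => k; rewrite ltnS => /andP[_ kN].
(* The sums over [n] and [i] are swapped by viewing them as one sum over the pairs with
   [k <= n i]. *)
rewrite esum_esum // (reindex_esum ([set: nat] `*`` 
    (fun i => bose_states N `&` [set n | (k <= n i)%N])) _ (fun q => (q.2, q.1))); last first.
  split => [[i n] [_ [/= Nn kn]]|[i n] [i' n'] _ _ /= [-> ->]|[n i] [/= Nn kn]] //.
  by exists (i, n).
rewrite -(esum_esum (a := fun _ n => (weight n)%:E)) //.
(* Writing [n] as [add_bosons i k m] with [m] a state of [N - k] bosons extracts the factor
   [x i ^+ k]. *)
apply: eq_esum => i _; rewrite (reindex_esum _ _ _ _ (add_bosons_bij i kN)).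
rewrite -esumZl ?exprn_ge0 ?expR_ge0 //.
by apply: eq_esum => m [finm _]; rewrite weight_add_bosons // EFinM.
Qed.

Lemma Z_BE0 : Z_BE eps beta 0 = 1%E.
Proof.
have B0 : bose_states 0 = [set fun=> 0%N].
  apply/seteqP; split => [n n0|_ ->] /=.
    by apply/funext => i; apply/eqP; rewrite -leqn0; apply: bose_states_le.
  split; last exact: fsbig1.
  by rewrite (_ : [set i | _] = set0) //; apply/seteqP; split => // i; rewrite /= eqxx.
rewrite /Z_BE /canonical_partition_function B0 esum_set1 ?lee_fin ?expR_ge0 //.
rewrite /occupation_energy fsbig1 ?mulr0 ?expR0 // => i _.
by rewrite mul0r.
Qed.

End BosePartitionFunction.

(** * Power sums and the identification of the two sides *)

Lemma esum_exprn (R : realType) (u : nat -> R) (k : nat) : (0 < k)%N ->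
  (forall i, 0 <= u i) -> (\sum_(0 <= i <oo) (u i)%:E < +oo)%E ->
  (\esum_(i in [set: nat]) (u i ^+ k)%:E = (limn (series (fun i => u i ^+ k)))%:E)%E.
Proof.
case: k => // k _ u0 sum_u; have cvg_u := nnseries_is_cvg u0 sum_u.
have le_u i : u i <= limn (series u).
  apply: (@le_trans _ _ (series u i.+1)).
    by rewrite /series /= big_nat_recr //= lerDr sumr_ge0.
  apply: nondecreasing_cvgn_le => // m n le_mn; apply: nondecreasing_series => // j _ _.
have cvg_uk : cvgn (series (fun i => u i ^+ k.+1)).
  (* Each [u i] is at most the total of the series, so one factor [u i] is kept and the other [k]
     are bounded by that total. *)
  apply: (@series_le_cvg _ _ (limn (series u) ^+ k *: u)).
  - by move=> i; rewrite exprn_ge0.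
  - by move=> i; rewrite mulr_ge0 ?exprn_ge0 // (le_trans (u0 i)).
  - by move=> i; rewrite exprSr ler_wpM2r // lerXn2r ?nnegrE ?(le_trans (u0 i)).
  - exact: is_cvg_seriesZ.
rewrite -nneseries_esumT => [|i]; last by rewrite lee_fin exprn_ge0.
rewrite -EFin_lim //; congr (limn _); apply/funext => n.
by rewrite /series /= sumEFin.
Qed.

(** The two factorials of [N] cancel, which leaves the inverse centralizer order times the power
    sums. *)
Lemma S_function1 (R : realType) (N : nat) (x : nat -> R) :
  S_function N [:: N] x = cycle_index (fun k => limn (series (fun i => x i ^+ k))) N.
Proof.
apply: eq_bigr => mu _; rewrite char_value1 mulr1 /class_size.
have N0 : N`!%:R != 0 :> R by rewrite pnatr_eq0 -lt0n fact_gt0.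
rewrite [X in X * _]mulrAC divff // mul1r -prodfV -big_split /=.
by apply: eq_bigr => j _; rewrite mulrC.
Qed.

Theorem theorem1 (R : realType) (N : nat) (beta : R) (eps : nat -> R)
  (N_ge1 : (1 <= N)%N) (beta_gt0 : 0 < beta)
  (eps_nondecreasing : nondecreasing_seq eps)
  (summable : (\sum_(0 <= i <oo) (expR (- beta * eps i))%:E < +oo)%E) :
  Z_BE eps beta N =
    (S_function N [:: N] (fun i : nat => expR (- beta * eps i)))%:E.
Proof.
rewrite S_function1; set p := fun k : nat => _.
(* The induction is strong and starts at 0, since the recurrence at [N.+1] calls on all sizes from
   [N] down to 0. *)
elim/ltn_ind: N {N_ge1} => -[_|N IH]; first by rewrite Z_BE0 cycle_index0.
have rec : (N.+1%:R%:E * Z_BE eps beta N.+1 = (N.+1%:R * cycle_index p N.+1)%:E)%E.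
  rewrite Z_BE_rec cycle_index_rec -sumEFin big_nat [RHS]big_nat.
  apply: eq_bigr => k /andP[k_gt0 _].
  have lt_k : (N.+1 - k < N.+1)%N by rewrite ltn_subrL k_gt0.
  rewrite IH //; under eq_esum do rewrite muleC.
  rewrite esumZl.
  - rewrite muleC [RHS]EFinM; congr (_ * _)%E.
    by apply: (esum_exprn k_gt0 _ summable) => i; apply: expR_ge0.
  (* The cycle index is nonnegative because, by induction, it equals a partition function. *)
  - rewrite -lee_fin -IH //; apply: esum_ge0 => n _.
    by rewrite lee_fin expR_ge0.
  - by move=> i; rewrite lee_fin exprn_ge0 ?expR_ge0.
(* Cancelling [N.+1] in [\bar R] is done by multiplying with its finite inverse. *)
have := congr1 (mule (N.+1%:R^-1)%:E) rec.
by rewrite muleA -!EFinM mulrA mulVf ?pnatr_eq0 // mul1e mul1r.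
Qed.
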